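(* Assume $K$ has characteristic zero. Let $g,r,d$ be integers with $r\ge 3$, $\rho(g,r,d)\ge 0$ and $d<g+r$. Let $\Gamma$ be a chain of $g$ loops connected by bridges with admissible edge lengths, let $X$ be a smooth projective curve of genus $g$ over $K$ such that the Berkovich analytic space $X^{\mathrm{an}}$ has skeleton isometric to $\Gamma$, and let $D_X$ be a divisor of degree $d$ and rank $r$ on $X$ such that the complete linear series $\mathcal{L}(D_X)$ is very ample and $\mu_2:\operatorname{Sym}^2\mathcal{L}(D_X)\to\mathcal{L}(2D_X)$ has maximal rank. Suppose that $\mu_2$ is surjective. Then the multiplication map $\mu_m:\operatorname{Sym}^m\mathcal{L}(D_X)\to\mathcal{L}(mD_X)$ is surjective for all $m\ge 2$.
   Context: $K$ is an algebraically closed field that is spherically complete with respect to a nonarchimedean valuation $\operatorname{val}$ whose value group is all of $\mathbb{R}$. $\rho(g,r,d)=g-(r+1)(g-d+r)$. For a divisor $D_X$ on $X$, $\mathcal{L}(D_X)$ is the $K$-vector space of rational functions $f$ on $X$ (including $0$) with $\operatorname{div}(f)+D_X$ effective; the rank of $D_X$ is $\dim\mathcal{L}(D_X)-1$. The map $\mu_m$ sends $f_1\cdots f_m$ to the product of the rational functions. A linear map between finite-dimensional vector spaces has maximal rank if it is injective or surjective. A skeleton of $X^{\mathrm{an}}$ is taken in the usual sense of Berkovich curves (the metric graph associated to a semistable vertex set, onto which $X^{\mathrm{an}}$ retracts). Chain of loops: $\Gamma$ is the compact metric graph with vertices $w_0,\dots,w_g$ and $v_1,\dots,v_{g+1}$.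 For $1\le k\le g$ there are two edges joining $v_k$ and $w_k$, the top edge of length $\ell_k$ and the bottom edge of length $m_k$ (together the $k$th loop). For $0\le k\le g$ there is one edge (bridge) $\beta_k$ of length $n_k$ joining $w_k$ and $v_{k+1}$. The edge lengths are admissible if, for all $1\le k\le g$, $4g\,m_k<\ell_k$ and $4\ell_k<\min\{n_{k-1},n_k\}$, and there is no nontrivial linear relation $c_1m_1+\cdots+c_gm_g=0$ with integer coefficients of absolute value at most $g+1$. *)

(* Defs.v *)
From HB Require Import structures.
From mathcomp Require Import all_boot all_order all_algebra.
From mathcomp Require Import all_classical all_reals all_analysis.
From mathcomp Require Export freeg.
From mathcomp Require mpoly.

Set Implicit Arguments.
Unset Strict Implicit.
Unset Printing Implicit Defensive.

Import Order.TTheory GRing.Theory Num.Theory.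
Import numFieldNormedType.Exports.

Local Open Scope classical_set_scope.
Local Open Scope ring_scope.

(** * The ground field *)

Section GroundField.
Variables (R : realType) (K : fieldType).

(* The value of [v] at [0] is junk and is never used. *)
Definition is_valuation (v : K -> R) :=
  (forall x y, x != 0 -> y != 0 -> v (x * y) = v x + v y) /\
  (forall x y, x != 0 -> y != 0 -> x + y != 0 ->
     Num.min (v x) (v y) <= v (x + y)).

Definition full_value_group (v : K -> R) :=
  forall t : R, exists2 x : K, x != 0 & v x = t.

Definition closed_ball_val (v : K -> R) (c : K) (t : R) : set K :=
  [set x | x = c \/ t <= v (x - c)].

Definition spherically_complete (v : K -> R) :=
  forall (c : nat -> K) (t : nat -> R),
    (forall i, closed_ball_val v (c i.+1) (t i.+1) `<=`
               closed_ball_val v (c i) (t i)) ->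
    exists x, forall i, closed_ball_val v (c i) (t i) x.

Definition absK (v : K -> R) (c : K) : R :=
  if c == 0 then 0 else expR (- v c).

End GroundField.

(** * Smooth projective curves

   A smooth projective (irreducible) curve [X] over an algebraically closed
   field [K] is given by its function field [iota : K -> F], as an abstract
   nonsingular curve: the closed points of [X] are the normalized discrete
   valuations of [F] trivial on [K]. *)

Section Curve.
Variables (K : fieldType) (F : fieldType) (iota : {rmorphism K -> F}).

Definition transcendental (x : F) :=
  forall p : {poly K}, p != 0 -> (map_poly iota p).[x] != 0.

(* [F] is a finite extension of [K(x)] for some [x] transcendental over [K];
   the coefficients in [K(x)] are put over a common denominator [q(x)]. *)
Definition function_field :=
  exists2 x : F, transcendental x &
  exists (n : nat) (y : 'I_n -> F), forall f : F,
  exists (q : {poly K}) (p : 'I_n -> {poly K}), q != 0 /\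
    (map_poly iota q).[x] * f = \sum_i (map_poly iota (p i)).[x] * y i.

(* The normalization at [0] makes equality of places the same as equality of
   valuations. *)
Record place := Place {
  ord :> F -> int;
  _ : ord 0 = 0;
  _ : forall f h, f != 0 -> h != 0 -> ord (f * h) = ord f + ord h;
  _ : forall f h, f != 0 -> h != 0 -> f + h != 0 ->
        Num.min (ord f) (ord h) <= ord (f + h);
  _ : forall c, c != 0 -> ord (iota c) = 0;
  _ : exists2 t, t != 0 & ord t = 1 }.

HB.instance Definition _ := gen_eqMixin place.
HB.instance Definition _ := gen_choiceMixin place.

Definition regular_at (P : place) (f : F) := f = 0 \/ 0 <= P f.

Definition vanishes_at (P : place) (f : F) := f = 0 \/ 0 < P f.

(* The value [f(P)] in [K] of a function [f] regular at [P]; it exists and is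
   unique when [K] is algebraically closed and [F] is a function field. *)
Definition value_at (P : place) (f : F) : K :=
  xget 0 [set c | vanishes_at P (f - iota c)].

Definition divisor := {freeg place / int}.

(* [f = 0], or [div(f) + D] is effective. *)
Definition lin_sys (D : divisor) : set F :=
  [set f | f = 0 \/ forall P : place, 0 <= P f + coeff P D].

Definition is_basis (V : set F) (n : nat) (b : 'I_n -> F) :=
  (forall i, V (b i)) /\
  forall f, V f -> exists! c : 'rV[K]_n, f = \sum_i iota (c 0 i) * b i.

(* The genus of a function field: the maximum of [deg D + 1 - dim L(D)]. *)
Definition has_genus (g : nat) :=
  (forall (D : divisor) (n : nat) (b : 'I_n -> F),
     is_basis (lin_sys D) b -> deg D + 1 - n%:Z <= g%:Z) /\
  (exists (D : divisor) (n : nat) (b : 'I_n -> F),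
     is_basis (lin_sys D) b /\ deg D + 1 - n%:Z = g%:Z).

(** ** Multiplication maps

   A basis [b] of [L(D)] identifies [Sym^m L(D)] with the homogeneous
   polynomials of degree [m] in [n = dim L(D)] variables, and the
   multiplication map with evaluation at [b]. *)

Definition mult_map (n : nat) (b : 'I_n -> F) (m : nat)
  (p : mpoly.dhomog n K m) : F := mpoly.mmap iota b (mpoly.mpoly_of_dhomog p).

Definition mult_surjective (D : divisor) n (b : 'I_n -> F) (m : nat) :=
  forall f, lin_sys (D *+ m) f ->
    exists p : mpoly.dhomog n K m, mult_map b p = f.

Definition mult_max_rank (D : divisor) n (b : 'I_n -> F) (m : nat) :=
  injective (@mult_map n b m) \/ mult_surjective D b m.

(** ** Very ampleness

   The complete linear series with basis [b] defines a closed embedding in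
   projective space. A point of [P(L(D))] is a hyperplane of [L(D)]: the image
   of [P] is the hyperplane [L(D - P)] of sections vanishing at [P]. The image
   in [F] of the local ring of projective space at the image of [P] consists of
   the fractions [a / c] of forms of the same degree [m], with [c] not
   vanishing at the image of [P], that is, with [c(b)] of order exactly
   [- m D(P)] at [P]. Since [X] is projective, an injective morphism is a
   homeomorphism onto a closed subset, and it is a closed embedding when it is
   also surjective on local rings. *)

Definition base_point_free (D : divisor) :=
  forall P : place, exists f, [/\ lin_sys D f, f != 0 & P f = - coeff P D].

Definition separates_points (D : divisor) :=
  forall P Q : place, P <> Q ->
    lin_sys (D - << P >>) <> lin_sys (D - << Q >>).

Definition surjective_on_local_rings (D : divisor) n (b : 'I_n -> F) :=
  forall (P : place) (h : F), regular_at P h ->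
  exists (m : nat) (a c : mpoly.dhomog n K m),
    [/\ mult_map b c != 0, P (mult_map b c) = - (coeff P D *+ m)
      & h = mult_map b a / mult_map b c].

Definition very_ample (D : divisor) n (b : 'I_n -> F) :=
  [/\ base_point_free D, separates_points D & surjective_on_local_rings D b].

End Curve.

(** * Berkovich analytification of a curve *)

Section Analytification.
Variables (R : realType) (K : fieldType) (v : K -> R).
Variables (F : fieldType) (iota : {rmorphism K -> F}).

Record absolute_value := AbsoluteValue {
  absF :> F -> R;
  _ : forall f, 0 <= absF f;
  _ : forall f h, absF (f * h) = absF f * absF h;
  _ : forall f h, absF (f + h) <= Num.max (absF f) (absF h);
  _ : forall c, absF (iota c) = absK v c }.

(* A point of [X^an] is a point of the scheme [X] with an absolute value on its
   residue field that extends the one of [K]. The residue field of a closed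
   point is [K], which has only one; that of the generic point is [F]. *)
Inductive analytification :=
| ClosedPt of place iota
| GenericPt of absolute_value.

(* The absolute value [|f|_x], with value [+oo] at the poles of [f]. *)
Definition abs_at (x : analytification) (f : F) : \bar R :=
  match x with
  | ClosedPt P =>
      if `[< regular_at P f >] then (absK v (value_at P f))%:E else +oo%E
  | GenericPt a => (a f)%:E
  end.

(* The coarsest topology for which [x |-> |f|_x] is continuous with values in
   [[0, +oo]] for all [f]. Since for every finite set of closed points there
   is a rational function with poles exactly there, this is also the coarsest
   for which the analytifications of the Zariski open sets are open and carry
   continuous functions [|f|], for [f] regular. *)
Definition abs_profile (x : analytification) : {ptws F -> \bar R} := abs_at x.

HB.instance Definition _ := gen_eqMixin analytification.
HB.instance Definition _ := gen_choiceMixin analytification.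
HB.instance Definition _ :=
  Topological.copy analytification (initial_topology abs_profile).

(* The structure sheaf. As [X^an] is reduced and [K] is algebraically closed,
   complete and nontrivially valued, an analytic function on an open [U] is
   determined by its values [s : U(K) -> K] (values outside [U(K)] are
   irrelevant). The analytic functions are the local uniform limits of rational
   functions without poles. *)
Definition analytic (U : set analytification) (s : place iota -> K) :=
  forall x, U x -> exists W : set analytification,
    [/\ open W, W x, W `<=` U &
      forall e : R, 0 < e -> exists f : F, forall P, W (ClosedPt P) ->
        regular_at P f /\ absK v (s P - value_at P f) < e].

(* Type 2: the residue field of [a] is transcendental over that of [K]. (By
   Abhyankar's inequality its transcendence degree is then 1.) The witness [f]
   has a transcendental reduction. *)
Definition type2 (x : analytification) :=
  match x with
  | ClosedPt _ => False
  | GenericPt a => exists f : F, a f <= 1 /\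
      forall p : {poly K}, (forall i, absK v p`_i <= 1) ->
        (exists i, absK v p`_i = 1) -> a (map_poly iota p).[f] = 1
  end.

End Analytification.

(* Isomorphism of analytic spaces between the open subset [U] of [X^an] and the
   open subset [W] of [Y^an]: a homeomorphism [phi] of inverse [psi], given by
   [phi0] and [psi0] on the [K]-points, that identifies the structure
   sheaves. *)
Definition analytic_iso (R : realType) (K : fieldType) (v : K -> R)
    (F G : fieldType) (iF : {rmorphism K -> F}) (iG : {rmorphism K -> G})
    (U : set (analytification v iF)) (W : set (analytification v iG))
    (phi : analytification v iF -> analytification v iG) :=
  exists (psi : analytification v iG -> analytification v iF)
         (phi0 : place iF -> place iG) (psi0 : place iG -> place iF),
  [/\ [/\ forall x, U x -> W (phi x), forall y, W y -> U (psi y),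
          forall x, U x -> psi (phi x) = x
        & forall y, W y -> phi (psi y) = y],
      {within U, continuous phi} /\ {within W, continuous psi},
      (forall P, U (ClosedPt v P) -> phi (ClosedPt v P) = ClosedPt v (phi0 P))
      /\ (forall Q, W (ClosedPt v Q) ->
            psi (ClosedPt v Q) = ClosedPt v (psi0 Q))
    & forall (W' : set (analytification v iG)) (s : place iG -> K),
        open W' -> W' `<=` W ->
        (analytic W' s <-> analytic (U `&` phi @^-1` W') (s \o phi0))].

(** * Balls and annuli in the analytic projective line *)

Section BallsAndAnnuli.
Variables (R : realType) (K : fieldType) (v : K -> R).

Definition iotaP1 : {rmorphism K -> {fraction {poly K}}} :=
  @tofrac {poly K} \o polyC.

Definition P1an := analytification v iotaP1.

Definition coordT : {fraction {poly K}} := tofrac 'X.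

Definition unit_ball : set P1an := [set y | (abs_at y coordT < 1)%E].

(* The open annulus of modulus [L]; since the value group is [R], every
   [L > 0] occurs as the valuation of an element of [K]. *)
Definition annulus (L : R) : set P1an :=
  [set y | ((expR (- L))%:E < abs_at y coordT < 1)%E].

(* [y] is the Gauss point of radius [exp(-s)]. *)
Definition is_gauss_point (s : R) (y : P1an) :=
  forall p : {poly K}, abs_at y (tofrac p) =
    (\big[Num.max/0]_(i < size p) (absK v p`_i * expR (- (s *+ i))))%:E.

End BallsAndAnnuli.

Arguments unit_ball {R K} v _.
Arguments annulus {R K} v L _.

(** * Path metrics and metric graphs *)

Section PathMetric.
Variables (R : realType) (T : Type) (step : T -> T -> R -> Prop).

Inductive walk : T -> T -> R -> Prop :=
| WalkNil p : walk p p 0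
| WalkCons p q r a b : step p q a -> walk q r b -> walk p r (a + b).

Definition path_dist (p q : T) : \bar R :=
  ereal_inf [set l%:E | l in [set l | walk p q l]].

End PathMetric.

Record metric_graph (R : realType) := MetricGraph {
  vert : Type;
  edge : Type;
  source : edge -> vert;
  target : edge -> vert;
  len : edge -> R }.

Section MetricGraph.
Variables (R : realType) (G : metric_graph R).

Inductive gpoint :=
| Vertex of vert G
| Inner (e : edge G) (t : R) of 0 < t < len e.

(* [p] is the point at distance [t] from the source along the edge [e]. *)
Definition edge_at (e : edge G) (t : R) (p : gpoint) :=
  [\/ t = 0 /\ p = Vertex (source e),
      t = len e /\ p = Vertex (target e)
    | exists h : 0 < t < len e, p = Inner h].

Definition graph_step (p q : gpoint) (l : R) :=
  exists (e : edge G) (s t : R),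
    [/\ edge_at e s p, edge_at e t q & l = `|s - t|].

Definition graph_dist : gpoint -> gpoint -> \bar R := path_dist graph_step.

End MetricGraph.

(** * Skeletons *)

Section Skeleton.
Variables (R : realType) (K : fieldType) (v : K -> R).
Variables (F : fieldType) (iota : {rmorphism K -> F}).
Local Notation Xan := (analytification v iota).
Implicit Types (V C : set Xan).

Definition is_component V C :=
  exists2 x, (~` V) x & C = connected_component (~` V) x.

Definition is_open_ball C := exists phi, analytic_iso C (unit_ball v) phi.

Definition is_open_annulus C :=
  exists (L : R) phi, 0 < L /\ analytic_iso C (annulus v L) phi.

Definition semistable_vertex_set V :=
  [/\ finite_set V,
      forall x, V x -> type2 x,
      forall C, is_component V C -> is_open_ball C \/ is_open_annulus C
    & finite_set [set C | is_component V C /\ is_open_annulus C]].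

(* [gam : [0, L] -> X^an] is the closure of the skeleton of a component [C] of
   the complement of [V] that is an open annulus of modulus [L], parametrized
   by arc length. *)
Definition is_skeleton_edge V (gam : R -> Xan) (L : R) :=
  [/\ 0 < L, {within `[0, L], continuous gam}, V (gam 0), V (gam L) &
    exists C phi, [/\ is_component V C, analytic_iso C (annulus v L) phi &
      forall s : R, 0 < s < L -> C (gam s) /\ is_gauss_point s (phi (gam s))]].

Definition skeleton V : set Xan :=
  V `|` [set x | exists gam (L s : R),
                   [/\ is_skeleton_edge V gam L, 0 < s < L & x = gam s]].

Definition skeleton_step V (x y : Xan) (l : R) :=
  exists gam (L s t : R), [/\ is_skeleton_edge V gam L,
    0 <= s <= L, 0 <= t <= L, x = gam s /\ y = gam t & l = `|s - t|].

Definition skeleton_dist V : Xan -> Xan -> \bar R :=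
  path_dist (skeleton_step V).

Definition has_skeleton_isometric_to (G : metric_graph R) :=
  exists V, semistable_vertex_set V /\
  exists psi : gpoint G -> Xan,
    [/\ injective psi, range psi = skeleton V
      & forall p q, skeleton_dist V (psi p) (psi q) = graph_dist p q].

End Skeleton.

(** * Chains of loops *)

(* [ChainW k] is [w_k] and [ChainV k] is [v_(k+1)], for [0 <= k <= g]. *)
Inductive chain_vert (g : nat) := ChainW of 'I_g.+1 | ChainV of 'I_g.+1.

(* [Top i] and [Bottom i] are the edges of the loop [i + 1]. *)
Inductive chain_edge (g : nat) :=
| Top of 'I_g | Bottom of 'I_g | Bridge of 'I_g.+1.

Section ChainOfLoops.
Variables (R : realType) (g : nat).
(* For [i : 'I_g], [l i] and [m i] are the lengths written [l_(i+1)] and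
   [m_(i+1)] with the loops numbered from [1]. *)
Variables (l m : 'I_g -> R) (n : 'I_g.+1 -> R).

Definition before (i : 'I_g) : 'I_g.+1 := widen_ord (leqnSn g) i.
Definition after (i : 'I_g) : 'I_g.+1 := fintype.lift ord0 i.

Definition chain_of_loops : metric_graph R :=
  @MetricGraph R (chain_vert g) (chain_edge g)
    (fun e => match e with
              | Top i | Bottom i => ChainV (before i)
              | Bridge k => ChainW k
              end)
    (fun e => match e with
              | Top i | Bottom i => ChainW (after i)
              | Bridge k => ChainV k
              end)
    (fun e => match e with
              | Top i => l i
              | Bottom i => m i
              | Bridge k => n k
              end).

Definition admissible :=
  [/\ [/\ forall i, 0 < l i, forall i, 0 < m i & forall k, 0 < n k],
      forall i, 4 * g%:R * m i < l i,
      forall i, 4 * l i < Num.min (n (before i)) (n (after i))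
    & forall c : 'I_g -> int, (forall i, `|c i| <= g%:Z + 1) ->
        \sum_i (c i)%:~R * m i = 0 -> forall i, c i = 0].

End ChainOfLoops.

Definition rho (g r d : int) : int := g - (r + 1) * (g - d + r).

(* Main.v *)
Require Import Defs.
From mathcomp Require Import all_boot all_order all_algebra.
From mathcomp Require Import all_classical all_reals all_analysis.
From mathcomp Require Import zify.
From mathcomp Require Import (canonicals, coercions) mpoly.

(* Let [h = h^1(D) = g - d + r]. The surjectivity of [mu_2] bounds
   [dim L(2D) >= 2d + 1 - g] by ['C(r + 2, 2)], which with [rho >= 0] gives
   [2h <= r]. Choose general effective divisors [X] and [Y] of degree [h], so
   that [H^1(D + X) = H^1(D + Y) = 0], and a nonzero section [v0] of
   [L(D - X - Y)]. If [v] lies in [L(D - X)] or in [L(D - Y)], the pencil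
   [<v0, v>] has a base divisor [B] with [H^1(D + B) = 0], so that the
   base-point-free pencil trick gives
   [v0 L(mD) + v L(mD) = L((m+1)D - B)] for [m >= 2]. As [L(D - X)] and
   [L(D - Y)] have no common base point, summing over [v] gives
   [L(D) L(mD) = L((m+1)D)]. The vanishing of [H^1(E)] is expressed as the
   existence of functions with every prescribed pole order beyond [E]. *)

Set Implicit Arguments.
Unset Strict Implicit.
Unset Printing Implicit Defensive.

Import Order.TTheory GRing.Theory Num.Theory.
Local Open Scope ring_scope.

(** * Orders of functions at a place *)

Section PlaceTheory.
Variables (K F : fieldType) (iota : {rmorphism K -> F}).
Implicit Types (P : place iota) (f h : F) (k : int).

Lemma ordM P f h : f != 0 -> h != 0 -> P (f * h) = P f + P h.
Proof. by case: P => o ? H *; apply: H. Qed.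

Lemma ord_const P c : c != 0 -> P (iota c) = 0.
Proof. by case: P => o ? ? ? H *; apply: H. Qed.

Lemma ord_uniformizer P : exists2 t, t != 0 & P t = 1.
Proof. by case: P. Qed.

Lemma ord1 P : P 1 = 0.
Proof. by rewrite -(rmorph1 iota) ord_const ?oner_neq0. Qed.

Lemma ordV P f : f != 0 -> P f^-1 = - P f.
Proof.
move=> f0; apply/eqP; rewrite -addr_eq0 addrC -ordM ?invr_neq0 //.
by rewrite mulfV // ord1.
Qed.

Lemma ordX P f n : f != 0 -> P (f ^+ n) = P f *+ n.
Proof.
move=> f0; elim: n => [|n IH]; first by rewrite ord1.
by rewrite exprS ordM ?expf_neq0 // IH mulrS.
Qed.

Lemma ordN P f : P (- f) = P f.
Proof.
have [->|f0] := eqVneq f 0; first by rewrite oppr0.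
rewrite -mulN1r ordM ?oppr_eq0 ?oner_neq0 //.
by rewrite -(rmorph1 iota) -rmorphN ord_const ?add0r // oppr_eq0 oner_neq0.
Qed.

(** Places send 0 to 0 by convention, so the zero function, of infinite order, needs its own
    clause. *)
Definition order_ge P k f := f = 0 \/ k <= P f.

Lemma order_ge0 P k : order_ge P k 0. Proof. by left. Qed.

Lemma order_ge_nz P k f : f != 0 -> order_ge P k f -> k <= P f.
Proof. by move=> /eqP f0 []. Qed.

Lemma order_ge_trans P k k' f : k' <= k -> order_ge P k f -> order_ge P k' f.
Proof. by move=> le_k [->|H]; [left|right; apply: le_trans H]. Qed.

Lemma order_geD P k f h :
  order_ge P k f -> order_ge P k h -> order_ge P k (f + h).
Proof.
move=> [->|Hf]; first by rewrite add0r.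
move=> [->|Hh]; first by rewrite addr0; right.
have [->|f0] := eqVneq f 0; first by rewrite add0r; right.
have [->|h0] := eqVneq h 0; first by rewrite addr0; right.
have [->|s0] := eqVneq (f + h) 0; first by left.
right; case: P Hf Hh => o /= _ _ H _ _ Hf Hh.
by apply: le_trans (H _ _ f0 h0 s0); rewrite le_min Hf.
Qed.

Lemma order_geN P k f : order_ge P k f -> order_ge P k (- f).
Proof. by move=> [->|H]; [left; rewrite oppr0|right; rewrite ordN]. Qed.

Lemma order_geB P k f h :
  order_ge P k f -> order_ge P k h -> order_ge P k (f - h).
Proof. by move=> Hf Hh; apply/order_geD/order_geN. Qed.

Lemma order_geM P k k' f h :
  order_ge P k f -> order_ge P k' h -> order_ge P (k + k') (f * h).
Proof.
move=> [->|Hf]; first by rewrite mul0r; left.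
move=> [->|Hh]; first by rewrite mulr0; left.
have [->|f0] := eqVneq f 0; first by rewrite mul0r; left.
have [->|h0] := eqVneq h 0; first by rewrite mulr0; left.
by right; rewrite ordM // lerD.
Qed.

Lemma order_ge_const P c : order_ge P 0 (iota c).
Proof.
have [->|c0] := eqVneq c 0; first by left; rewrite rmorph0.
by right; rewrite ord_const.
Qed.

Lemma order_geZ P k c f : order_ge P k f -> order_ge P k (iota c * f).
Proof. by move=> H; rewrite -(add0r k); apply: order_geM (order_ge_const _ _) H. Qed.

Lemma order_geX P f n : order_ge P 0 f -> order_ge P 0 (f ^+ n).
Proof.
move=> Hf; elim: n => [|n IH]; first by right; rewrite ord1.
by rewrite exprS -(addr0 0); apply: order_geM.
Qed.

Lemma order_ge_sum P k (I : Type) (s : seq I) (Q : pred I) (f : I -> F) :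
  (forall i, Q i -> order_ge P k (f i)) ->
  order_ge P k (\sum_(i <- s | Q i) f i).
Proof.
by move=> H; elim/big_ind: _ => //; [apply: order_ge0|apply: order_geD].
Qed.

(** If [f + h] had order above [P f], so would [f = (f + h) - h]. *)
Lemma ord_dominant P f h : f != 0 -> order_ge P (P f + 1) h ->
  f + h != 0 /\ P (f + h) = P f.
Proof.
move=> f0 Hh.
have H : order_ge P (P f + 1) (f + h) -> False.
  move=> /order_geB/(_ Hh); rewrite addrK => /(order_ge_nz f0); lia.
have fh0 : f + h != 0 by apply/negP => /eqP E; apply: H; left.
split=> //.
have H1 : order_ge P (P f) (f + h).
  by apply: order_geD; [right|apply: order_ge_trans Hh; lia].
have := order_ge_nz fh0 H1; have : ~ (P f + 1 <= P (f + h)) by move=> ?; apply: H; right.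
lia.
Qed.

End PlaceTheory.

(** * Linear relations over a field and over an integral domain *)

Section LinearRelations.
Import generic_quotient.
Local Open Scope quotient_scope.

Lemma fraction_numden (A : idomainType) (u : {fraction A}) :
  exists a e : A, e != 0 /\ tofrac e * u = tofrac a.
Proof.
elim/quotW: u => q; exists (frac q).1, (frac q).2; split; first exact: denom_ratioP.
rewrite -[tofrac _ * _]/(FracField.mul _ _) !piE.
apply/eqmodP; rewrite /= /FracField.equivf /FracField.mulf.
by rewrite !numden_Ratio ?mul1r ?mulf_neq0 ?oner_neq0 ?denom_ratioP // !mulr1 mulrC.
Qed.

Lemma linear_relation (k : fieldType) m n (M : 'M[k]_(m, n)) :
  (n < m)%N -> exists2 u : 'rV_m, u != 0 & u *m M = 0.
Proof.
move=> lt_nm; have : kermx M != 0.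
  rewrite -mxrank_eq0 mxrank_ker -lt0n subn_gt0.
  exact: leq_ltn_trans (rank_leq_col _) lt_nm.
move=> /eqP/eqP/rowV0Pn [u /sub_kermxP uM u0]; by exists u.
Qed.

(** A kernel vector over the fraction field is scaled by the product of its denominators. *)
Lemma linear_relation_idomain (A : idomainType) m n (p : 'I_m -> 'I_n -> A) :
  (n < m)%N -> exists w : 'I_m -> A,
    (exists i, w i != 0) /\ forall j, \sum_i w i * p i j = 0.
Proof.
move=> lt_nm.
have [u u0 uM] := linear_relation (\matrix_(i, j) tofrac (p i j)) lt_nm.
pose ae i := cid (fraction_numden (u 0 i)).
pose a i := sval (ae i); pose e i := sval (cid (svalP (ae i))).
have e0 i : e i != 0 by case: (svalP (cid (svalP (ae i)))).
have eu i : tofrac (e i) * u 0 i = tofrac (a i) by case: (svalP (cid (svalP (ae i)))).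
pose w i := a i * \prod_(k | k != i) e k.
have wE i : tofrac (w i) = tofrac (\prod_k e k) * u 0 i.
  by rewrite (bigD1 i) //= !rmorphM /= -eu mulrAC.
have E0 : tofrac (\prod_k e k) != 0.
  by rewrite tofrac_eq0; apply/prodf_neq0.
exists w; split.
  have [i ui0] : exists i, u 0 i != 0 by apply/rV0Pn.
  by exists i; rewrite -tofrac_eq0 wE mulf_neq0.
move=> j; apply/eqP; rewrite -tofrac_eq0 rmorph_sum /=.
under eq_bigr do rewrite rmorphM /= wE -mulrA.
rewrite -mulr_sumr mulf_eq0; apply/orP; right.
have /rowP/(_ j) := uM; rewrite !mxE => uMj.
by apply/eqP; apply: etrans uMj; apply: eq_bigr => i _; rewrite mxE.
Qed.

End LinearRelations.

(** * Functions are algebraic over [K(x)] *)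

Section AlgebraicRelations.
Variables (K F : fieldType) (iota : {rmorphism K -> F}).

Local Notation "q .{ x }" := (map_poly iota q).[x] (at level 2, format "q .{ x }").

(** Multiplied by denominators, the [n.+1] powers of [f] are combinations of [n] generators over
    [K[x]], hence dependent. *)
Lemma algebraic_relation (X_curve : function_field iota) :
  exists2 x, transcendental iota x & forall f : F,
  exists n (q : 'I_n -> {poly K}),
    (exists i, q i != 0) /\ \sum_i (q i).{x} * f ^+ i = 0.
Proof.
case: X_curve => x x_tr [n [y gen]]; exists x => // f; exists n.+1.
pose den i := cid (gen (f ^+ i)).
pose q i := sval (den i); pose p i := sval (cid (svalP (den i))).
have q0 i : q i != 0 by case: (svalP (cid (svalP (den i)))).
have qf i : (q i).{x} * f ^+ i = \sum_j (p i j).{x} * y j.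
  by case: (svalP (cid (svalP (den i)))).
have [w [[i wi] wp]] :=
  @linear_relation_idomain {poly K} n.+1 n (fun i j => p i j) (leqnn _).
exists (fun i => w i * q i); split; first by exists i; rewrite mulf_neq0.
under eq_bigr do rewrite rmorphM /= hornerM -mulrA qf mulr_sumr.
rewrite exchange_big big1 //= => j _.
under eq_bigr do rewrite mulrA -hornerM -rmorphM.
by rewrite -mulr_suml -horner_sum -rmorph_sum wp rmorph0 horner0 mul0r.
Qed.

Lemma horner_vanish (P : place iota) (z : F) (a : {poly K}) : order_ge P 1 z ->
  order_ge P 1 (a.{z} - iota a`_0).
Proof.
move=> Pz; elim/poly_ind: a => [|a c IH].
  by rewrite rmorph0 horner0 coef0 rmorph0 subr0; left.
rewrite rmorphD rmorphM /= map_polyX map_polyC /= !hornerE coefD coefMX coefC eqxx.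
rewrite add0r addrK.
rewrite -[1]add0r; apply: order_geM => //.
rewrite -[a.{z}](subrK (iota a`_0)); apply: order_geD.
  exact: order_ge_trans IH.
exact: order_ge_const.
Qed.

Lemma horner_iota (p : {poly K}) (f : F) (n : nat) : (size p <= n)%N ->
  p.{f} = \sum_(i < n) iota p`_i * f ^+ i.
Proof.
move=> le_pn; rewrite (@horner_coef_wide _ n) ?size_map_poly //.
by apply: eq_bigr => i _; rewrite coef_map.
Qed.

End AlgebraicRelations.

(** * Residue fields of places *)

Section Residue.
Variables (K : closedFieldType) (F : fieldType) (iota : {rmorphism K -> F}).
Implicit Types (P : place iota) (f h : F).
Local Notation "q .{ x }" := (map_poly iota q).[x] (at level 2, format "q .{ x }").

Lemma horner_closed (p : {poly K}) (f : F) : exists s : seq K,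
  p.{f} = iota (lead_coef p) * \prod_(a <- s) (f - iota a).
Proof.
have [s {1}->] := closed_field_poly_normal p; exists s.
rewrite map_polyZ hornerZ; congr (_ * _).
elim: s => [|a s IH]; first by rewrite !big_nil rmorph1 hornerC.
rewrite !big_cons rmorphM hornerM IH; congr (_ * _).
by rewrite rmorphB /= map_polyX map_polyC !hornerE.
Qed.

(** The polynomial splits, and a product of regular functions [f - iota a] vanishes at [P] only if a
    factor does. *)
Lemma vanishing_root P f (p : {poly K}) : p != 0 -> order_ge P 1 p.{f} ->
  order_ge P 0 f -> exists a, order_ge P 1 (f - iota a).
Proof.
move=> p0 H Pf; have [s E] := horner_closed p f; move: H; rewrite E => H.
have Pfa a : order_ge P 0 (f - iota a) by apply: order_geB Pf (order_ge_const _ _).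
have {H} : order_ge P 1 (\prod_(a <- s) (f - iota a)).
  have := order_geZ (lead_coef p)^-1 H.
  by rewrite mulrA -rmorphM mulVf ?lead_coef_eq0 // rmorph1 mul1r.
elim: s {E} => [|a s IH].
  by rewrite big_nil => /order_ge_nz; rewrite oner_neq0 ord1 => /(_ isT).
rewrite big_cons => H.
have [fa0|fa0] := eqVneq (f - iota a) 0; first by exists a; left.
have [s0|s0] := eqVneq (\prod_(a <- s) (f - iota a)) 0.
  by apply: IH; left.
have := order_ge_nz (mulf_neq0 fa0 s0) H; rewrite ordM // => lt1.
have [le1|gt1] := leP 1 (P (f - iota a)); first by exists a; right.
by apply: IH; right; have := order_ge_nz fa0 (Pfa a); lia.
Qed.

(** Once the common power of [z] is divided out, the relation reduces modulo the maximal ideal of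
    [P] to a nonzero polynomial over [K], and [vanishing_root] applies. *)
Lemma residue_of_relation P (z f : F) n (q : 'I_n -> {poly K}) :
  z != 0 -> 0 < P z -> order_ge P 0 f -> (exists i, q i != 0) ->
  \sum_i (q i).{z} * f ^+ i = 0 -> exists a, order_ge P 1 (f - iota a).
Proof.
move=> z0 Pz Pf [i0 qi0] rel.
have ex : exists k, [exists i, (q i)`_k != 0].
  exists (size (q i0)).-1; apply/existsP; exists i0.
  by rewrite -[_`__]/(lead_coef _) lead_coef_eq0.
(* ['X^k] is the largest power of ['X] dividing every [q i]. *)
case: (ex_minnP ex) => k /existsP [i1 qi1] kmin.
have qE i : q i = drop_poly k (q i) * 'X^k.
  rewrite -[LHS](poly_take_drop k) [take_poly _ _](_ : _ = 0) ?add0r //.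
  apply/polyP => j; rewrite coef_take_poly coef0; case: ltnP => // lt_jk.
  apply/eqP; apply: contraTT lt_jk => qj; rewrite -leqNgt; apply: kmin.
  by apply/existsP; exists i.
have {}rel : \sum_i (drop_poly k (q i)).{z} * f ^+ i = 0.
  apply: (mulIf (expf_neq0 k z0)); rewrite mul0r -[RHS]rel mulr_suml.
  apply: eq_bigr => i _; rewrite [in RHS]qE rmorphM /= map_polyXn hornerM hornerXn.
  by rewrite mulrAC.
(* Of the divided coefficients only the constant terms survive modulo [z]; [p] collects them. *)
pose p := \poly_(i < n) (oapp (fun j => (q j)`_k) 0 (insub i)).
have pE (i : 'I_n) : p`_i = (q i)`_k.
  by rewrite coef_poly ltn_ord valK.
have p0 : p != 0 by apply: contraNneq qi1 => p0; rewrite -pE p0 coef0.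
apply: (vanishing_root p0) => //.
rewrite (horner_iota iota f (size_poly _ _)) .
rewrite -[X in order_ge _ _ X]subr0 -[X in _ - X]rel -sumrB.
apply: order_ge_sum => i _; rewrite pE -mulrBl -[1]addr0.
apply: order_geM (order_geX _ Pf); rewrite -opprB; apply: order_geN.
have := @horner_vanish _ _ iota P z (drop_poly k (q i)).
by rewrite coef_drop_poly add0n; apply; right.
Qed.

(** A relation of [f] over [K[x]] is rewritten over [K[z]] with [z] vanishing at [P]: [x^-1] if [x]
    has a pole there, some [x - iota c] otherwise. *)
Lemma residue_exists (X_curve : function_field iota) P f :
  order_ge P 0 f -> exists a, order_ge P 1 (f - iota a).
Proof.
move=> Pf; have [x x_tr alg] := algebraic_relation X_curve.
have horner_neq0 q : q != 0 -> q.{x} != 0 by apply: x_tr.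
have x0 : x != 0.
  by have := horner_neq0 'X; rewrite polyX_eq0 map_polyX hornerX; apply.
have [n [q [qn0 rel]]] := alg f.
have [x_pole|x_reg] := ltP (P x) 0.
  pose N := (\max_i size (q i))%N.
  (* Reversed coefficients: [q' i] at [x^-1] is [q i] at [x] divided by [x ^+ N]. *)
  pose q' i := \poly_(j < N.+1) (q i)`_(N - j).
  have szq i : (size (q i) <= N.+1)%N by exact/leqW/(leq_bigmax (F := fun i => size (q i))).
  apply: (@residue_of_relation P x^-1 f n q') => //.
  - by rewrite invr_eq0.
  - by rewrite ordV //; lia.
  - case: qn0 => i qi0; exists i; apply: contraNneq qi0 => qi0.
    apply/eqP/polyP => j; rewrite coef0; have [lt_jN|le_Nj] := ltnP j N.+1.
      have /polyP/(_ (N - j)%N) := qi0; rewrite coef_poly coef0 ltnS leq_subr.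
      by rewrite subKn.
    by apply: nth_default; apply: leq_trans (szq i) le_Nj.
  apply: (mulfI (expf_neq0 N x0)); rewrite mulr0 -[RHS]rel mulr_sumr.
  apply: eq_bigr => i _; rewrite mulrA; congr (_ * _).
  rewrite (horner_iota iota _ (size_poly _ _)) (horner_iota iota _ (szq i)).
  rewrite mulr_sumr (reindex_inj rev_ord_inj) /=; apply: eq_bigr => j _.
  have le_jN : (j <= N)%N by rewrite -ltnS.
  rewrite coef_poly /= subSS ltnS leq_subr subKn // mulrCA; congr (_ * _).
  by rewrite exprVn -{2}(subKn le_jN) expfB_cond // (negbTE x0) leq_subr.
have [t t0 Pt] := ord_uniformizer P.
have [m [u [um0 relt]]] := alg t.
(* Otherwise every nonzero polynomial in [x] has order 0 at [P], so the nonzero terms of the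
   relation for the uniformizer [t] have distinct orders and cannot cancel. *)
have [c xc] : exists c, order_ge P 1 (x - iota c).
  apply: contrapT => no_c.
  have ordq p : p != 0 -> P p.{x} = 0.
    move=> p0; have := horner_neq0 p p0; have [s ->] := horner_closed p x.
    rewrite mulf_eq0 negb_or => /andP [l0 s0].
    rewrite ordM // ord_const ?lead_coef_eq0 // add0r.
    elim: s s0 => [|a s IH]; first by rewrite big_nil ord1.
    rewrite big_cons mulf_eq0 negb_or => /andP [a0 s0]; rewrite ordM // IH // addr0.
    have : order_ge P 0 (x - iota a).
      by apply: order_geB (order_ge_const _ _); right.
    move=> /(order_ge_nz a0) ge0.
    have [lt1|gt1] := leP 1 (P (x - iota a)); last by lia.
    by case: no_c; exists a; right.
  case: um0 => i0 ui0; case: (@arg_minnP _ i0 (fun i => u i != 0) val ui0) => j uj jmin.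
  have uj' : (u j).{x} * t ^+ j != 0 by rewrite mulf_neq0 ?horner_neq0 ?expf_neq0.
  have Puj : P ((u j).{x} * t ^+ j) = j.
    by rewrite ordM ?horner_neq0 ?expf_neq0 // ordq // ordX // Pt add0r natz.
  move: relt; rewrite (bigD1 j) //= => relt.
  have [] := @ord_dominant _ _ _ P _ (\sum_(i < m | i != j) (u i).{x} * t ^+ i) uj'; last first.
    by rewrite relt eqxx.
  rewrite Puj; apply: order_ge_sum => i' ne_i'.
  have [ui'0|ui'0] := eqVneq (u i') 0; first by left; rewrite ui'0 rmorph0 horner0 mul0r.
  right; rewrite ordM ?horner_neq0 ?expf_neq0 // ordq // ordX // Pt add0r natz.
  by have /= := jmin i' ui'0; move: ne_i'; rewrite -val_eqE /=; lia.
apply: (@residue_of_relation P (x - iota c) f n (fun i => q i \Po ('X + c%:P))) => //.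
- have := horner_neq0 ('X - c%:P); rewrite rmorphB /= map_polyX map_polyC !hornerE.
  by apply; rewrite polyXsubC_eq0.
- have := horner_neq0 ('X - c%:P).
  rewrite rmorphB /= map_polyX map_polyC !hornerE polyXsubC_eq0 => /(_ isT) xc0.
  by rewrite gtz0_ge1; apply: order_ge_nz xc0 xc.
- by case: qn0 => i qi0; exists i; rewrite comp_poly2_eq0 // size_XaddC.
rewrite -[RHS]rel; apply: eq_bigr => i _; congr (_ * _).
by rewrite map_comp_poly horner_comp rmorphD /= map_polyX map_polyC !hornerE subrK.
Qed.

End Residue.

Local Open Scope classical_set_scope.

(** * Divisors and their linear systems *)

Section Divisors.
Variables (K F : fieldType) (iota : {rmorphism K -> F}).
Implicit Types (P Q : place iota) (f h : F) (D E A : divisor iota).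

Definition div_le D E := forall P, coeff P D <= coeff P E.

Lemma div_lexx D : div_le D D. Proof. by move=> P. Qed.

Lemma div_le_trans D E A : div_le D E -> div_le E A -> div_le D A.
Proof. by move=> DE EA P; apply: le_trans (EA P). Qed.

Lemma coeff_point P Q : coeff Q << P >> = if P == Q then 1 else 0 :> int.
Proof. by rewrite coeffU mul1r; case: eqP. Qed.

(* [coeff_fgposE] with [coeff] over the ring structure of [int] found by
   inference, which [lia] does not identify with the one in [coeff_fgposE]. *)
Lemma coeff_fgpos D P : coeff P (fgpos D) = Num.max 0 (coeff P D).
Proof. exact: coeff_fgposE. Qed.

Lemma div_leD D E A : div_le 0 A -> div_le D E -> div_le D (E + A).
Proof. by move=> A0 DE P; have := A0 P; have := DE P; rewrite coeffD coeff0; lia. Qed.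

Lemma div_leDl E A : div_le 0 A -> div_le E (E + A).
Proof. by move=> A0; apply: div_leD. Qed.

Lemma div_leD2r D E A : div_le D E -> div_le (D + A) (E + A).
Proof. by move=> DE P; rewrite !coeffD lerD2r. Qed.

Lemma point_ge0 P : div_le 0 << P >>.
Proof. by move=> Q; rewrite coeff0 coeff_point; case: ifP. Qed.

Lemma deg_ge0 A : div_le 0 A -> 0 <= deg A.
Proof.
move=> A0; rewrite -[A]freeg_sumE raddf_sum /=; apply: sumr_ge0 => P _.
by rewrite degU; have := A0 P; rewrite coeff0.
Qed.

Lemma deg_le D E : div_le D E -> deg D <= deg E.
Proof.
move=> DE; rewrite -subr_ge0 -degB; apply: deg_ge0 => P.
by rewrite coeff0 coeffB subr_ge0.
Qed.

Lemma effective_gt0 A : div_le 0 A -> A != 0 -> exists P, 0 < coeff P A.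
Proof.
move=> A0 /eqP An0; apply: contrapT => no.
apply: An0; apply/eqP/freeg_eqP => P.
have := A0 P; rewrite coeff0 le_eqVlt => /orP [/eqP <-//|lt].
by case: no; exists P.
Qed.

(** Induction on the degree, which drops when a point of the support is removed. *)
Lemma effective_ind (Pr : divisor iota -> Prop) : Pr 0 ->
  (forall A P, div_le 0 A -> Pr A -> Pr (A + << P >>)) ->
  forall A, div_le 0 A -> Pr A.
Proof.
move=> Pr0 PrS A A0; have [n] : exists n : nat, deg A <= n%:Z.
  by exists `|deg A|%N; lia.
elim: n A A0 => [|n IH] A A0 le_n;
  have [->//|An0] := eqVneq A 0; have [P AP] := effective_gt0 A0 An0.
- have : div_le << P >> A.
    move=> Q; rewrite coeff_point; case: eqP => [<-|_]; first by lia.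
    by have := A0 Q; rewrite coeff0.
  by move=> /deg_le; rewrite degU; lia.
have A'0 : div_le 0 (A - << P >>).
  move=> Q; rewrite coeffB coeff_point coeff0; case: eqP => [<-|_]; first by lia.
  by have := A0 Q; rewrite coeff0; lia.
rewrite -(subrK << P >> A); apply: PrS => //; apply: IH => //.
by rewrite degB degU; lia.
Qed.

Lemma lin_sysP D f :
  lin_sys D f <-> forall P, order_ge P (- coeff P D) f.
Proof.
split=> [[->|H] P|H]; first by left.
  by right; have := H P; lia.
have [->|f0] := eqVneq f 0; [by left|right=> P].
by have := order_ge_nz f0 (H P); lia.
Qed.

Lemma lin_sys0 D : lin_sys D 0. Proof. by left. Qed.

Lemma lin_sysD D f h : lin_sys D f -> lin_sys D h -> lin_sys D (f + h).
Proof. by move=> /lin_sysP Hf /lin_sysP Hh; apply/lin_sysP => P; apply: order_geD. Qed.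

Lemma lin_sysZ D c f : lin_sys D f -> lin_sys D (iota c * f).
Proof. by move=> /lin_sysP Hf; apply/lin_sysP => P; apply: order_geZ. Qed.

Lemma lin_sysB D f h : lin_sys D f -> lin_sys D h -> lin_sys D (f - h).
Proof. by move=> /lin_sysP Hf /lin_sysP Hh; apply/lin_sysP => P; apply: order_geB. Qed.

Lemma lin_sys_le D E : div_le D E -> lin_sys D `<=` lin_sys E.
Proof.
move=> DE f /lin_sysP Hf; apply/lin_sysP => P; apply: order_ge_trans (Hf P).
by have := DE P; lia.
Qed.

Lemma lin_sysM D E f h : lin_sys D f -> lin_sys E h -> lin_sys (D + E) (f * h).
Proof.
move=> /lin_sysP Hf /lin_sysP Hh; apply/lin_sysP => P.
by rewrite coeffD opprD; apply: order_geM.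
Qed.

Lemma lin_sys_ord D f P : f != 0 -> lin_sys D f -> - coeff P D <= P f.
Proof. by move=> f0 /lin_sysP/(_ P)/(order_ge_nz f0). Qed.

Definition is_div (f : F) (Z : divisor iota) := forall P, coeff P Z = P f.

(** Linear equivalence: multiplication by [f] carries [L(E)] onto [L(E - Z)]. *)
Lemma lin_sys_equiv E f Z h : f != 0 -> is_div f Z ->
  lin_sys (E - Z) h <-> lin_sys E (h / f).
Proof.
move=> f0 fZ; split=> [Lh|Lh].
  have Lf : lin_sys Z f^-1.
    by apply/lin_sysP => P; right; rewrite fZ ordV.
  by rewrite -(subrK Z E); apply: lin_sysM.
have Lf : lin_sys (- Z) f.
  by apply/lin_sysP => P; right; rewrite coeffN fZ opprK.
by rewrite -(divfK f0 h); apply: lin_sysM.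
Qed.

End Divisors.

(** * Linear independence and dimension over [K] *)

Section Bases.
Variables (K F : fieldType) (iota : {rmorphism K -> F}).
Implicit Types (V : set F) (f : F).

Definition combination n (b : 'I_n -> F) (c : 'rV[K]_n) : F :=
  \sum_i iota (c 0 i) * b i.

Definition independent n (b : 'I_n -> F) :=
  forall c, combination b c = 0 -> c = 0.

Definition spanned_by n (b : 'I_n -> F) : set F :=
  [set f | exists c, f = combination b c].

Lemma combinationD n (b : 'I_n -> F) c c' :
  combination b (c + c') = combination b c + combination b c'.
Proof. by rewrite -big_split; apply: eq_bigr => i _; rewrite mxE rmorphD mulrDl. Qed.

Lemma combinationZ n (b : 'I_n -> F) a c :
  combination b (a *: c) = iota a * combination b c.
Proof. by rewrite mulr_sumr; apply: eq_bigr => i _; rewrite mxE rmorphM mulrA. Qed.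

Lemma combinationB n (b : 'I_n -> F) c c' :
  combination b (c - c') = combination b c - combination b c'.
Proof. by rewrite combinationD -scaleN1r combinationZ rmorphN1 mulN1r. Qed.

Lemma combination0 n (b : 'I_n -> F) : combination b 0 = 0.
Proof. by rewrite /combination big1 // => i _; rewrite mxE rmorph0 mul0r. Qed.

Lemma is_basis_independent V n (b : 'I_n -> F) :
  V 0 -> is_basis iota V b -> independent b.
Proof.
move=> V0 [_ H] c bc; have [c' [_ uniq_c]] := H 0 V0.
by rewrite -(uniq_c c (esym bc)); apply: uniq_c; rewrite -/(combination _ _) combination0.
Qed.

Lemma is_basis_span V n (b : 'I_n -> F) : is_basis iota V b -> V `<=` spanned_by b.
Proof. by move=> [_ H] f /H [c [-> _]]; exists c. Qed.

Lemma is_basisI V n (b : 'I_n -> F) : (forall i, V (b i)) ->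
  V `<=` spanned_by b -> independent b -> is_basis iota V b.
Proof.
move=> Vb span ind; split=> // f /span [c fE]; exists c; split=> // c' fE'.
apply/eqP; rewrite -subr_eq0; apply/eqP/ind.
by rewrite combinationB -fE -[combination b c']fE' subrr.
Qed.

(** For [m < n] the matrix expressing [b] in [a] has a nonzero left kernel, which gives a relation
    among the [b i]. *)
Lemma independent_le n m (b : 'I_n -> F) (a : 'I_m -> F) : independent b ->
  (forall i, spanned_by a (b i)) -> (n <= m)%N.
Proof.
move=> ind ba; rewrite leqNgt; apply/negP => lt_mn.
pose M := \matrix_(i, j) sval (cid (ba i)) 0 j.
have bE i : b i = \sum_j iota (M i j) * a j.
  by have := svalP (cid (ba i)) => {1}->; apply: eq_bigr => j _; rewrite mxE.
have [u u0 uM] := linear_relation M lt_mn.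
case/negP: u0; apply/eqP/ind; rewrite /combination.
under eq_bigr do rewrite bE mulr_sumr.
rewrite exchange_big big1 //= => j _.
under eq_bigr do rewrite mulrA -rmorphM.
rewrite -mulr_suml -rmorph_sum; have /rowP/(_ j) := uM; rewrite !mxE => ->.
by rewrite rmorph0 mul0r.
Qed.

Lemma independentM n (b : 'I_n -> F) f : f != 0 -> independent b ->
  independent (fun i => f * b i).
Proof.
move=> f0 ind c /eqP; rewrite /combination.
under eq_bigr do rewrite mulrCA.
by rewrite -mulr_sumr mulf_eq0 (negbTE f0) => /eqP/ind.
Qed.

End Bases.

(** * Adding points to a divisor; nonspecial divisors *)

Section CurveTheory.
Variables (K : closedFieldType) (F : fieldType) (iota : {rmorphism K -> F}).
Variable X_curve : function_field iota.
Implicit Types (P Q : place iota) (f h u : F) (D E A B Z : divisor iota).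

(** The constant [c] is the residue of [f / u], which is regular at [P]. *)
Lemma cancel_leading P u f : u != 0 -> order_ge P (P u) f ->
  exists c, order_ge P (P u + 1) (f - iota c * u).
Proof.
move=> u0 Hf; have /(residue_exists X_curve) [c Hc] : order_ge P 0 (f / u).
  rewrite -(subrr (P u)); apply: order_geM Hf _.
  by right; rewrite ordV.
exists c; have -> : f - iota c * u = u * (f / u - iota c).
  by rewrite mulrBr mulrCA mulfV // mulr1 [u * _]mulrC.
by apply: order_geM Hc; right.
Qed.

Lemma new_pole E P u : lin_sys (E + << P >>) u -> ~ lin_sys E u ->
  u != 0 /\ P u = - coeff P E - 1.
Proof.
move=> Lu nLu; have u0 : u != 0 by apply: contra_not_neq nLu => ->; left.
split=> //; have := lin_sys_ord P u0 Lu; rewrite coeffD coeff_point eqxx.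
have [ge _|lt] := leP (- coeff P E) (P u); last by lia.
case: nLu; apply/lin_sysP => Q; have [<-|ne_PQ] := eqVneq P Q.
  by right.
by have /lin_sysP/(_ Q) := Lu; rewrite coeffD coeff_point (negbTE ne_PQ) addr0.
Qed.

(** Only the leading coefficient at [P] obstructs membership in [L(E)], and [u] can cancel it. *)
Lemma reduce_pole E P u f : lin_sys (E + << P >>) u -> ~ lin_sys E u ->
  lin_sys (E + << P >>) f -> exists c, lin_sys E (f - iota c * u).
Proof.
move=> Lu nLu Lf; have [u0 Pu] := new_pole Lu nLu.
have [|c Hc] := @cancel_leading P u f u0.
  have /lin_sysP/(_ P) := Lf; rewrite coeffD coeff_point eqxx Pu.
  by apply: order_ge_trans; lia.
exists c; have /lin_sysP H := lin_sysB Lf (lin_sysZ c Lu).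
apply/lin_sysP => Q; have [<-|ne_PQ] := eqVneq P Q.
  by apply: order_ge_trans Hc; lia.
by have := H Q; rewrite coeffD coeff_point (negbTE ne_PQ) addr0.
Qed.

Definition has_dim E n := exists b : 'I_n -> F, is_basis iota (lin_sys E) b.

Lemma has_dim_eq E E' n : lin_sys E = lin_sys E' -> has_dim E n -> has_dim E' n.
Proof. by rewrite /has_dim => ->. Qed.

(** Either no section is new, or one section [u] with the new pole completes a basis of [L(E)]. *)
Lemma has_dim_point E P n : has_dim E n ->
  exists2 n', (n' <= n.+1)%N & has_dim (E + << P >>) n'.
Proof.
move=> dimE; have leE : div_le E (E + << P >>).
  exact: div_leD (point_ge0 _) (div_lexx _).
have [sub|/existsNP [u /not_implyP [Lu nLu]]] := pselect (lin_sys (E + << P >>) `<=` lin_sys E).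
  exists n => //; apply: has_dim_eq dimE.
  by apply/seteqP; split; [apply: lin_sys_le|].
have [b b_basis] := dimE; exists n.+1 => //.
exists (fun i => oapp b u (unlift ord0 i)).
have combS c : combination iota (fun i => oapp b u (unlift ord0 i)) c =
    iota (c 0 ord0) * u + combination iota b (\row_j c 0 (lift ord0 j)).
  rewrite /combination big_ord_recl unlift_none; congr (_ + _).
  by apply: eq_bigr => i _; rewrite liftK mxE.
apply: is_basisI.
- move=> i; case: unliftP => [j _|_] //=; apply: lin_sys_le leE _ _.
  by case: b_basis.
- move=> f Lf; have [c /(is_basis_span b_basis) [d dE]] := reduce_pole Lu nLu Lf.
  exists (\row_i oapp (fun j => d 0 j) c (unlift ord0 i)).
  rewrite combS mxE unlift_none /=; set e := (X in combination _ _ X).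
  have -> : e = d by apply/rowP => j; rewrite !mxE liftK.
  by rewrite -dE addrC subrK.
- move=> c; rewrite combS => /eqP H; have [c0|c0] := eqVneq (c 0 ord0) 0.
    move: H; rewrite c0 rmorph0 mul0r add0r => /eqP.
    move/(is_basis_independent (lin_sys0 E) b_basis)/rowP => H.
    apply/rowP => i; rewrite mxE; case: (unliftP ord0 i) => [j|] -> //.
    by have := H j; rewrite !mxE.
  case: nLu; rewrite addrC addr_eq0 in H.
  rewrite -[u](mulKf (x := iota (c 0 ord0))) ?fmorph_eq0 //.
  have -> : iota (c 0 ord0) * u = iota (- 1) * combination iota b (\row_j c 0 (lift ord0 j)).
    by rewrite (eqP H) rmorphN1 mulN1r opprK.
  rewrite -fmorphV; do 2!apply: lin_sysZ.
  rewrite /combination; elim/big_ind: _ => [|? ? |i _]; [exact: lin_sys0|exact: lin_sysD|].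
  by apply: lin_sysZ; case: b_basis.
Qed.

Lemma has_dim_add E A n : div_le 0 A -> has_dim E n ->
  exists2 n', n'%:Z <= n%:Z + deg A & has_dim (E + A) n'.
Proof.
move=> A0; elim/effective_ind: A / A0 => [|A P _ IH] dimE.
  by exists n; rewrite ?deg0 ?addr0.
have [n' le_n' dim'] := IH dimE; have [n'' le_n'' dim''] := has_dim_point P dim'.
by exists n''; rewrite ?addrA // degD degU; lia.
Qed.

(* The vanishing of [H^1(X, O(E))]. *)
Definition nonspecial E := forall E' P, div_le E E' ->
  ~ (lin_sys (E' + << P >>) `<=` lin_sys E').

Lemma nonspecial_le E E' : div_le E E' -> nonspecial E -> nonspecial E'.
Proof. by move=> EE' NE E'' P /(div_le_trans EE'); apply: NE. Qed.

Lemma nonspecial_equiv E f Z : f != 0 -> is_div f Z -> nonspecial E ->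
  nonspecial (E - Z).
Proof.
move=> f0 fZ NE E' P le_E' sub; apply: (NE (E' + Z) P).
  by move=> Q; have := le_E' Q; rewrite coeffB coeffD; lia.
move=> h Lh; rewrite -(mulfK f0 h); apply/(lin_sys_equiv _ _ f0 fZ).
rewrite addrK; apply: sub; rewrite -(addrK Z (E' + _)).
by apply/(lin_sys_equiv _ _ f0 fZ); rewrite mulfK // addrAC.
Qed.

(** In cohomology, a section with the new pole at [P] makes [H^1(E) -> H^1(E + P)] injective. *)
Lemma nonspecial_sub E P : ~ (lin_sys (E + << P >>) `<=` lin_sys E) ->
  nonspecial (E + << P >>) -> nonspecial E.
Proof.
move=> /existsNP [u /not_implyP [Lu nLu]] NE E' Q le_E' sub.
have [u0 Pu] := new_pole Lu nLu.
have [le1|gt1] := leP (coeff P E + 1) (coeff P E').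
  apply: NE sub => R; rewrite coeffD coeff_point; case: eqP => [<-|_] //.
  by rewrite addr0.
have EP : coeff P E' = coeff P E by have := le_E' P; lia.
have Lu' : lin_sys (E' + << P >>) u.
  by apply: lin_sys_le Lu; apply: div_leD2r.
have nLu' : ~ lin_sys E' u.
  by move=> /(lin_sys_ord P u0); rewrite Pu EP; lia.
have [eq_PQ|ne_PQ] := eqVneq P Q; first by apply/nLu'/sub; rewrite -eq_PQ.
(* A section [f] of [E' + P + Q] loses its extra pole at [P] to a multiple of [u], then the one at
   [Q] by [sub]. *)
apply: (NE (E' + << P >>) Q).
  exact: div_leD2r.
move=> f Lf; have [|||c Lfc] := @reduce_pole (E' + << Q >>) P u f.
- by apply: lin_sys_le Lu'; apply/div_leD2r/div_leDl/point_ge0.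
- move=> /(lin_sys_ord P u0); rewrite coeffD coeff_point eq_sym (negbTE ne_PQ) Pu EP; lia.
- by rewrite addrAC.
rewrite -(subrK (iota c * u) f); apply: lin_sysD; last exact: lin_sysZ.
by apply: lin_sys_le (sub _ Lfc); apply/div_leDl/point_ge0.
Qed.

(* The coefficientwise form of [O(E1) + O(E2) = O(max(E1, E2))], whose kernel
   has no [H^1] since [C <= min(E1, E2)]. *)
Lemma lin_sys_sum C E1 E2 f : nonspecial C -> div_le C E1 -> div_le C E2 ->
  (forall P, order_ge P (- Num.max (coeff P E1) (coeff P E2)) f) ->
  exists f1 f2, [/\ lin_sys E1 f1, lin_sys E2 f2 & f = f1 + f2].
Proof.
move=> NC CE1; have [n] : exists n : nat, deg E2 <= deg C + n%:Z.
  by exists `|deg E2 - deg C|%N; lia.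
elim: n E2 f => [|n IH] E2 f le_n CE2 Hf;
  have [Lf|nLf] := pselect (lin_sys E1 f);
  try by exists f, 0; split=> //; [left|rewrite addr0].
all: have [P /not_orP [f0 /negP]] : exists P, ~ order_ge P (- coeff P E1) f
  by (apply/existsNP => H; apply/nLf/lin_sysP).
all: move/eqP in f0; rewrite -ltNge => fP; have := order_ge_nz f0 (Hf P) => fP'.
all: have E12P : coeff P E1 < coeff P E2 by lia.
(* At [P] the pole of [f] exceeds [E1], so [C <= E1 < E2] there and a point can be taken off
   [E2]. *)
all: have CE2' : div_le C (E2 - << P >>)
  by (move=> Q; rewrite coeffB coeff_point; have := CE2 Q; have := CE1 Q;
      case: eqP => [<-|_]; lia).
  by have := deg_le CE2'; rewrite degB degU; lia.
(* This [u] in [L(E2)] has the full pole order allowed at [P]; a multiple of it lowers the pole of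
   [f] there. *)
have /existsNP [u /not_implyP [Lu nLu]] := NC (E2 - << P >>) P CE2'.
have [u0 Pu] := new_pole Lu nLu.
move: Pu Lu; rewrite coeffB coeff_point eqxx subrK => Pu Lu.
have [|c Hc] := @cancel_leading P u f u0; first by right; lia.
have [|||f1 [f2 [L1 L2 fE]]] := IH (E2 - << P >>) (f - iota c * u) => //.
- by rewrite degB degU; lia.
- move=> Q; rewrite coeffB coeff_point; have [<-|ne_PQ] := eqVneq P Q.
    by apply: order_ge_trans Hc; lia.
  apply: order_geB; first by apply: order_ge_trans (Hf Q); lia.
  have /lin_sysP/(_ Q) := lin_sysZ c Lu; apply: order_ge_trans; lia.
exists f1, (f2 + iota c * u); split=> //; last by rewrite addrA -fE subrK.
apply: lin_sysD; last exact: lin_sysZ.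
by apply: lin_sys_le L2; rewrite -{2}(subrK << P >> E2); apply/div_leDl/point_ge0.
Qed.
End CurveTheory.

(** * Consequences of Riemann's inequality *)

Section GenusTheory.
Variables (K : closedFieldType) (F : fieldType) (iota : {rmorphism K -> F}).
Variables (X_curve : function_field iota) (g : nat) (X_genus : has_genus iota g).
Implicit Types (P Q : place iota) (f h u : F) (D E A B Z : divisor iota).

Lemma riemann_inequality E n : has_dim E n -> deg E + 1 - n%:Z <= g%:Z.
Proof. by move=> [b b_basis]; case: X_genus => H _; apply: H b_basis. Qed.

Lemma genus_attained : exists E n, has_dim E n /\ deg E + 1 - n%:Z = g%:Z.
Proof. by case: X_genus => _ [E [n [b [b_basis H]]]]; exists E, n; split=> //; exists b. Qed.

(** Above a divisor attaining the genus each added point must raise the dimension, or Riemann's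
    inequality fails. *)
Lemma nonspecial_exists : exists E, nonspecial E.
Proof.
have [E [n [dimE En]]] := genus_attained; exists E => E' P le_EE' sub.
have [|n' le_n' dim'] := @has_dim_add _ _ _ X_curve E (E' - E) n _ dimE.
  by move=> Q; rewrite coeff0 coeffB subr_ge0.
have {dim'} : has_dim (E' + << P >>) n'.
  apply: has_dim_eq dim'; rewrite addrC subrK; apply/seteqP; split=> //.
  exact/lin_sys_le/div_leDl/point_ge0.
move=> /riemann_inequality; move: le_n'; rewrite degB degD degU; lia.
Qed.

Lemma nonzero_section A : g%:Z <= deg A -> exists2 f, f != 0 & lin_sys A f.
Proof.
move=> le_g; apply: contrapT => no.
have : has_dim A 0; last by move=> /riemann_inequality; lia.
exists (fun=> 0); split; first by case.
move=> f Lf; have -> : f = 0.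
  by apply/eqP/negPn/negP => f0; apply: no; exists f.
exists 0; split; first by rewrite big_ord0.
by move=> c _; apply/rowP; case.
Qed.

(** With [E0] attaining the genus, multiplication by [f] embeds [L(E0 + fgneg E)] in
    [L(E0 + fgpos E)]. Riemann's inequality bounds the first dimension below and [has_dim_add] the
    second above, so [deg (fgneg E) <= deg (fgpos E)]. *)
Lemma lin_sys_deg_ge0 E f : f != 0 -> lin_sys E f -> 0 <= deg E.
Proof.
move=> f0 Lf; have [E0 [n0 [dim0 En0]]] := genus_attained.
have pos0 : div_le 0 (fgpos E) by move=> P; rewrite coeff0 coeff_fgposE; lia.
have neg0 : div_le 0 (fgneg E) by move=> P; rewrite coeff0 coeff_fgnegE; lia.
have [n1 le_n1 dim1] := has_dim_add X_curve pos0 dim0.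
have [n2 _ dim2] := has_dim_add X_curve neg0 dim0.
have := riemann_inequality dim2; rewrite degD.
have [[b1 B1] [b2 B2]] := (dim1, dim2).
have le_n21 : (n2 <= n1)%N.
  apply: (independent_le (b := fun i => f * b2 i) (a := b1)).
    exact/(independentM f0)/(is_basis_independent _ B2)/lin_sys0.
  move=> i; apply: (is_basis_span B1).
  have -> : E0 + fgpos E = E + (E0 + fgneg E).
    by rewrite {2}(fg_decomp E) addrCA subrK.
  by apply: lin_sysM => //; case: B2.
have : deg E = deg (fgpos E) - deg (fgneg E) by rewrite -degB -fg_decomp.
lia.
Qed.

(** Points where [f] has order above that of [- E] are removed from [E]. The degree stays
    nonnegative, so this stops, and then [- E] is the divisor of [f]. *)
Lemma div_exists E f : f != 0 -> lin_sys E f ->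
  exists2 Z, is_div f Z & div_le 0 (E + Z).
Proof.
move=> f0 LEf; suff [Z fZ] : exists Z, is_div f Z.
  exists Z => // P; rewrite coeff0 coeffD fZ.
  by have := lin_sys_ord P f0 LEf; lia.
have [n] : exists n : nat, deg E <= n%:Z by exists `|deg E|%N; lia.
elim: n E LEf => [|n IH] E Lf le_n;
  (have [H|/existsNP [P /eqP EP]] := pselect (forall P, P f = - coeff P E);
   first by exists (- E) => P; rewrite coeffN H).
all: have Lf' : lin_sys (E - << P >>) f.
all: try (apply/lin_sysP => Q; rewrite coeffB coeff_point;
  have [<-|_] := eqVneq P Q; last (by rewrite subr0; have /lin_sysP := Lf);
  by right; have := lin_sys_ord P f0 Lf; lia).
  by have := lin_sys_deg_ge0 f0 Lf'; rewrite degB degU; lia.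
by apply: IH Lf' _; rewrite degB degU; lia.
Qed.

(** For a nonspecial [E0], a nonzero section of [E - E0] makes [E] equivalent to a divisor above
    [E0]. *)
Lemma nonspecial_large : exists N : int, forall E, N <= deg E -> nonspecial E.
Proof.
have [E0 NE0] := nonspecial_exists; exists (g%:Z + deg E0) => E le_N.
have [|f f0 Lf] := @nonzero_section (E - E0); first by rewrite degB; lia.
have [Z fZ EZ] := div_exists f0 Lf.
rewrite -(addrK Z E); apply: (nonspecial_equiv f0 fZ).
apply: nonspecial_le NE0 => P; have := EZ P.
by rewrite coeff0 !coeffD coeffN; lia.
Qed.

(** Iteration of [nonspecial_sub]: as the points are distinct, a new pole at [Q] is still new once a
    pole at [P] is allowed. *)
Lemma nonspecial_sub_seq (s : seq (place iota)) E : uniq s ->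
  (forall P, P \in s -> ~ (lin_sys (E + << P >>) `<=` lin_sys E)) ->
  nonspecial (E + \sum_(P <- s) << P >>) -> nonspecial E.
Proof.
elim: s E => [|P s IH] E /=; first by rewrite big_nil addr0.
move=> /andP [Ps s_uniq] bad; rewrite big_cons addrA => NE.
apply: (nonspecial_sub X_curve (P := P)); first by apply: bad; rewrite mem_head.
apply: IH => // Q Qs sub; apply: (bad Q); first by rewrite inE Qs orbT.
move=> u Lu; apply: contrapT => nLu; have [u0 Qu] := new_pole Lu nLu.
have /(lin_sys_ord Q u0) : lin_sys (E + << P >>) u.
  by apply: sub; rewrite addrAC; apply: lin_sys_le Lu; apply/div_leDl/point_ge0.
rewrite coeffD coeff_point Qu; case: eqP => [eq_PQ|_]; last by lia.
by move: Ps; rewrite eq_PQ Qs.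
Qed.

(** Otherwise enough distinct places with a new section could be added to reach a degree where all
    divisors are nonspecial, and this would descend to [E]. *)
Lemma special_stationary E : ~ nonspecial E -> exists s : seq (place iota),
  forall P, P \notin s -> lin_sys (E + << P >>) `<=` lin_sys E.
Proof.
move=> sE; apply: contrapT => no; have [N large] := nonspecial_large.
have [s [s_uniq s_size s_bad]] : exists s : seq (place iota),
    [/\ uniq s, size s = `|N - deg E|%N
      & forall P, P \in s -> ~ (lin_sys (E + << P >>) `<=` lin_sys E)].
  elim: `|N - deg E|%N => [|n [s [s_uniq s_size s_bad]]]; first by exists [::].
  have /existsNP [P /not_implyP [Ps bad]] :
      ~ forall P, P \notin s -> lin_sys (E + << P >>) `<=` lin_sys E.
    by move=> H; apply: no; exists s.
  exists (P :: s); split=> /=; rewrite ?Ps ?s_size //.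
  by move=> Q; rewrite inE => /orP [/eqP ->|/s_bad].
apply/sE/(nonspecial_sub_seq s_uniq s_bad)/large.
rewrite degD raddf_sum /=; under eq_bigr do rewrite degU.
by rewrite big_const_seq count_predT s_size iter_addr addr0 natz; lia.
Qed.

(** * Regular functions are constant, and places are infinite in number *)

Section Finiteness.
Variables (D : divisor iota) (n : nat) (D_dim : has_dim D n).
Variables (s : F) (s0 : s != 0) (Ls : lin_sys D s).

(** All [s * f ^+ i] lie in the finite-dimensional [L(D)], so [f] is algebraic over the
    algebraically closed [K]. *)
Lemma regular_constant f : lin_sys (0 : divisor iota) f -> exists c, f = iota c.
Proof.
move=> Lf; have [b b_basis] := D_dim.
have Lsf i : lin_sys D (s * f ^+ i).
  elim: i => [|i IH]; first by rewrite mulr1.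
  by rewrite exprSr mulrA -[D]addr0; apply: lin_sysM.
have /existsNP [c /not_implyP [rel /eqP c0]] :
    ~ independent iota (fun i : 'I_n.+1 => s * f ^+ i).
  move=> ind; have := independent_le ind (fun i => is_basis_span b_basis (Lsf i)).
  by rewrite ltnn.
pose p := rVpoly c.
have p0 : p != 0 by apply: contra_neq c0 => p0; rewrite -[c]rVpolyK -/p p0 linear0.
have {rel} : (map_poly iota p).[f] = 0.
  apply: (mulfI s0); rewrite mulr0 -[RHS]rel.
  rewrite (horner_iota iota f (size_poly _ _)) mulr_sumr.
  by apply: eq_bigr => i _; rewrite mulrCA coef_rVpoly_ord.
have [t ->] := horner_closed iota p f; move=> /eqP.
rewrite mulf_eq0 fmorph_eq0 lead_coef_eq0 (negbTE p0) /=.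
by rewrite prodf_seq_eq0 => /hasP [a _ /=]; rewrite subr_eq0 => /eqP; exists a.
Qed.

(** Let [c] differ from the values of [x] on [t]. If [t] held all places, [(x - iota c)^-1] would
    have no pole and be constant, against the transcendence of [x]. *)
Lemma place_notin (t : seq (place iota)) : exists P, P \notin t.
Proof.
have [x x_tr _] := algebraic_relation X_curve.
have xc c : x - iota c != 0.
  have := x_tr ('X - c%:P); rewrite rmorphB /= map_polyX map_polyC !hornerE.
  by apply; rewrite polyXsubC_eq0.
(* The default 0 is taken at the poles of [x]; avoiding it as well is harmless. *)
pose root_at P := xget 0 [set c | order_ge P 1 (x - iota c)].
have [c cP] : exists c, c \notin [seq root_at P | P <- t].
  have [|c] := @closed_nonrootP K (\prod_(a <- [seq root_at P | P <- t]) ('X - a%:P)) _.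
    by rewrite prodf_seq_neq0; apply/allP => a _; rewrite polyXsubC_eq0.
  by rewrite root_prod_XsubC; exists c.
have c_root P : P \in t -> ~ order_ge P 1 (x - iota c).
  move=> Pt Pc; move/negP: cP; apply; apply/mapP; exists P => //.
  rewrite /root_at; case: xgetP => [_ -> /= Pa|/(_ c)//].
  apply/eqP; rewrite -subr_eq0; apply: contraTT isT => ac0.
  have := order_geB Pa Pc; rewrite opprB addrC addrA subrK -rmorphB => /order_ge_nz.
  by rewrite fmorph_eq0 ord_const // => /(_ ac0).
apply: contrapT => no.
have tP P : P \in t by apply: contrapT => /negP H; apply: no; exists P.
have /regular_constant [a aE] : lin_sys (0 : divisor iota) (x - iota c)^-1.
  right=> P; rewrite coeff0 addr0 ordV //.
  have lt1 : ~ (1 <= P (x - iota c)) by move=> le1; apply: (c_root P (tP P)); right.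
  lia.
have := xc (c + a^-1); rewrite rmorphD fmorphV -aE invrK.
by rewrite opprD addrA subrr eqxx.
Qed.

End Finiteness.
End GenusTheory.

(** * Effective divisors of general points *)

Section GeneralPoints.
Variables (K : closedFieldType) (F : fieldType) (iota : {rmorphism K -> F}).
Variables (X_curve : function_field iota) (g : nat) (X_genus : has_genus iota g).
Variables (D : divisor iota) (n : nat) (D_dim : has_dim D n).
Implicit Types (P Q : place iota) (f h u v w : F) (A B M Z : divisor iota).

(** Here [w] is viewed as a section of [O(D)], whence the order. *)
Definition nonvanishing_at P w := w != 0 /\ P w = - coeff P D.

(** If [L(D - A)] were 0, adding [A] back would give dimension at most [deg A]. *)
Lemma section_vanishing A : div_le 0 A -> deg A < n%:Z ->
  exists2 f, f != 0 & lin_sys (D - A) f.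
Proof.
move=> A0 lt_n; apply: contrapT => no.
have dim0 : has_dim (D - A) 0.
  exists (fun=> 0); apply: is_basisI => [[]//|f Lf|c _]; last by apply/rowP; case.
  exists 0; rewrite combination0; apply/eqP/negPn/negP => f0.
  by apply: no; exists f.
have [n' le_n'] := has_dim_add X_curve A0 dim0; rewrite subrK => -[b' B'].
have [b B] := D_dim.
have : (n <= n')%N; last by lia.
apply: (independent_le (is_basis_independent (lin_sys0 D) B)) => i.
by apply: (is_basis_span B'); case: B.
Qed.

(** Take a nonzero [u] in [L(D - A - b)]. Away from its zeros a multiple of [u] cancels [w] at [P],
    leaving the leading term of [w] at [b] intact. *)
Lemma nonvanishing_step A b w : div_le 0 A -> deg A + 1 < n%:Z ->
  lin_sys (D - A) w -> nonvanishing_at b w ->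
  exists t : seq (place iota), forall P, P \notin t ->
  exists2 w', lin_sys (D - A - << P >>) w' & nonvanishing_at b w'.
Proof.
move=> A0 lt_n Lw [w0 bw].
have [||u u0] := @section_vanishing (A + << b >>).
- by apply: div_leD => //; apply: point_ge0.
- by rewrite degD degU.
rewrite opprD addrA => Lu.
have [Z uZ EZ] := div_exists X_curve X_genus u0 Lu.
(* The excluded places are [b] and the zeros of [u] as a section of [D - A - << b >>]. *)
exists (b :: dom (D - A - << b >> + Z)) => P.
rewrite inE negb_or eq_sym mem_dom negbK => /andP [ne_bP].
rewrite coeffD uZ coeffB coeff_point (negbTE ne_bP) subr0 addr_eq0 => /eqP Pu.
have [|c Hc] := @cancel_leading _ _ _ X_curve P u w u0.
  by have /lin_sysP/(_ P) := Lw; apply: order_ge_trans; lia.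
exists (w - iota c * u).
  apply/lin_sysP => Q; rewrite coeffB coeff_point.
  have [<-|_] := eqVneq P Q; first by apply: order_ge_trans Hc; lia.
  rewrite subr0; apply: order_geB; first by have /lin_sysP := Lw.
  apply: order_geZ; have /lin_sysP/(_ Q) := Lu; apply: order_ge_trans.
  by rewrite !coeffB coeff_point; case: eqP; lia.
have /ord_dominant : order_ge b (b w + 1) (- (iota c * u)).
  apply/order_geN/order_geZ; have /lin_sysP/(_ b) := Lu; apply: order_ge_trans.
  rewrite !coeffB coeff_point eqxx bw; have := A0 b; rewrite coeff0; lia.
by move=> /(_ w0) [ne_0 ordE]; split=> //; rewrite ordE.
Qed.

(* Points are added one at a time outside finite sets: adding a general point
   to a special divisor does not create new sections, and sections not
   vanishing on [S] can be corrected to vanish at a general point. *)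
Lemma general_points (S : seq (place iota)) k : (k < n)%N ->
  (forall b, b \in S -> exists2 w, lin_sys D w & nonvanishing_at b w) ->
  exists A, [/\ div_le 0 A, deg A = k,
    nonspecial (D + A) \/ lin_sys (D + A) `<=` lin_sys D
    & forall b, b \in S -> exists2 w, lin_sys (D - A) w & nonvanishing_at b w].
Proof.
elim: k => [|k IH] lt_kn HS.
  exists 0; split; rewrite ?deg0 //; first by right; rewrite addr0.
  by rewrite subr0.
have [A [A0 degA special bS]] := IH (ltnW lt_kn) HS.
have /choice [t tP] : forall b, exists t : seq (place iota), b \in S ->
    forall P, P \notin t ->
    exists2 w', lin_sys (D - A - << P >>) w' & nonvanishing_at b w'.
  move=> b; have [/bS [w Lw wb]|_] := boolP (b \in S); last by exists [::].
  have [|t tP] := nonvanishing_step A0 _ Lw wb; first by rewrite degA; lia.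
  by exists t.
(* If [D + A] is special, its sections already lie in [L(D)] and a general point adds none. *)
have [t' t'P] : exists t' : seq (place iota), nonspecial (D + A) \/
    forall P, P \notin t' -> lin_sys (D + A + << P >>) `<=` lin_sys D.
  have [NA|sA] := pselect (nonspecial (D + A)); first by exists [::]; left.
  have [t' t'P] := special_stationary X_curve X_genus sA.
  exists t'; right=> P /t'P sub; case: special => // sub'.
  exact: subset_trans sub sub'.
have [s s0 Ls] : exists2 s, s != 0 & lin_sys D s.
  have [|s s0] := section_vanishing (div_lexx 0); first by rewrite deg0; lia.
  by rewrite subr0; exists s.
have [P] := place_notin X_curve D_dim s0 Ls (t' ++ flatten [seq t b | b <- S]).
rewrite mem_cat negb_or => /andP [Pt' Pt].
exists (A + << P >>); split.
- by apply: div_leD => //; apply: point_ge0.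
- by rewrite degD degU degA; lia.
- rewrite addrA; case: t'P => [NA|H]; [left|by right; apply: H].
  by apply: nonspecial_le NA; apply/div_leDl/point_ge0.
- move=> b Sb; rewrite opprD addrA; apply: tP => //.
  by apply: contraNN Pt => Pt; apply/flatten_mapP; exists b.
Qed.

(** Were [D + A] special, a further general point [P] would add no section either, and
    [D + A + << P >>] would violate Riemann's inequality. *)
Lemma nonspecial_of_stationary A k : (0 < n)%N -> deg A = k%:Z ->
  g%:Z < deg D + k + 2 - n%:Z ->
  nonspecial (D + A) \/ lin_sys (D + A) `<=` lin_sys D -> div_le 0 A ->
  nonspecial (D + A).
Proof.
move=> n_gt0 degA lt_g [//|sub] A0; apply: contrapT => sA.
have [t tP] := special_stationary X_curve X_genus sA.
have [s s0 Ls] : exists2 s, s != 0 & lin_sys D s.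
  have [|s s0] := section_vanishing (div_lexx 0); first by rewrite deg0.
  by rewrite subr0; exists s.
have [P Pt] := place_notin X_curve D_dim s0 Ls t.
have : has_dim (D + A + << P >>) n.
  apply: has_dim_eq D_dim; apply/seteqP; split; last first.
    exact: subset_trans (tP P Pt) sub.
  by apply/lin_sys_le; rewrite -addrA; apply/div_leDl/div_leD => //; apply: point_ge0.
move=> /(riemann_inequality X_genus); rewrite !degD degU degA; lia.
Qed.

End GeneralPoints.

(** * Images of the multiplication maps *)

Section MultiplicationImage.
Variables (K F : fieldType) (iota : {rmorphism K -> F}) (n : nat) (b : 'I_n -> F).

Definition mult_image m : set F := [set f | exists p, mult_map iota b (m := m) p = f].

Lemma mult_imageD m f h : mult_image m f -> mult_image m h -> mult_image m (f + h).
Proof. by move=> [p <-] [q <-]; exists (p + q); rewrite -mpoly.mmapD. Qed.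

Lemma mult_imageZ m c f : mult_image m f -> mult_image m (iota c * f).
Proof. by move=> [p <-]; exists (c *: p); rewrite -mpoly.mmapZ. Qed.

Lemma mult_imageM m i f : mult_image m f -> mult_image m.+1 (b i * f).
Proof.
move=> [p <-]; pose x : mpoly.mpoly n K := mpoly.mpolyX K (mpoly.mnm1 i).
have x_homog : x \is mpoly.ishomog1 1 (@mpoly.mdeg n).
  by rewrite mpoly.dhomogX; apply/eqP/mpoly.mdeg1.
exists (mpoly.DHomog (mpoly.dhomogM x_homog (mpoly.dhomog_is_dhomog p))).
rewrite /mult_map /= (mpoly.mmap_is_multiplicative b iota).1.
by rewrite mpoly.mmapX mpoly.mmap1U.
Qed.

Lemma mult_image_span m v f : spanned_by iota b v -> mult_image m f ->
  mult_image m.+1 (v * f).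
Proof.
move=> [c ->] Tf; rewrite mulr_suml.
have T0 : mult_image m.+1 0 by exists 0; apply: mpoly.mmap0.
elim/big_ind: _ => // [|i _]; first exact: mult_imageD.
by rewrite -mulrA; apply/mult_imageZ/mult_imageM.
Qed.

End MultiplicationImage.

(** The binomial coefficient is the dimension of the space of forms; [a] is the image of a basis of
    forms. *)
Lemma mult_image_dim (K F : fieldType) (iota : {rmorphism K -> F}) n
    (b : 'I_n.+1 -> F) m :
  exists a : 'I_('C(m + n, m)) -> F, mult_image iota b m `<=` spanned_by iota a.
Proof.
have [v v_lin [w vK wK]] := mpoly.dhomog_vecaxiom n K m.
exists (fun i => mult_map iota b (w (delta_mx 0 i))) => f [p <-].
exists (v p).
have vD x y : v (x + y) = v x + v y by rewrite -[x]scale1r v_lin !scale1r.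
have v0 : v 0 = 0 by apply: (addrI (v 0)); rewrite -vD !addr0.
have vZ c x : v (c *: x) = c *: v x by rewrite -[c *: x]addr0 v_lin v0 addr0.
have {1}-> : p = \sum_i v p 0 i *: w (delta_mx 0 i).
  apply: (can_inj vK); rewrite (big_morph v vD v0) [LHS]row_sum_delta.
  by apply: eq_bigr => i _; rewrite vZ wK.
have mD : {morph mult_map iota b (m := m) : x y / x + y}.
  by move=> x y; apply: mpoly.mmapD.
have m0 : mult_map iota b (0 : mpoly.dhomog n.+1 K m) = 0 by apply: mpoly.mmap0.
rewrite (big_morph _ mD m0).
by apply: eq_bigr => i _; rewrite -mpoly.mmapZ.
Qed.

(** * Filling a linear system with products of sections *)

Section Descent.
Variables (K : closedFieldType) (F : fieldType) (iota : {rmorphism K -> F}).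
Variables (X_curve : function_field iota) (g : nat) (X_genus : has_genus iota g).
Variable D : divisor iota.
Implicit Types (P Q b : place iota) (f h u v w : F) (A B M Z : divisor iota).

Lemma has_dim_equiv E n f Z : f != 0 -> is_div f Z -> has_dim E n ->
  has_dim (E - Z) n.
Proof.
move=> f0 fZ [a a_basis]; exists (fun i => f * a i); apply: is_basisI.
- move=> i; apply/(lin_sys_equiv _ _ f0 fZ); rewrite mulrC mulKf //.
  by case: a_basis.
- move=> h /(lin_sys_equiv _ _ f0 fZ) /(is_basis_span a_basis) [c hE].
  exists c; rewrite -[h](divfK f0) hE mulrC mulr_sumr.
  by apply: eq_bigr => i _; rewrite mulrCA.
- exact/(independentM f0)/(is_basis_independent _ a_basis)/lin_sys0.
Qed.

(** [D *+ 2] is equivalent to [D + (D + Z)], which exceeds [D] by an effective divisor. *)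
Lemma has_dim_double n v : v != 0 -> lin_sys D v -> has_dim D n ->
  exists N, has_dim (D *+ 2) N.
Proof.
move=> v0 Lv dimD; have [Z vZ DZ] := div_exists X_curve X_genus v0 Lv.
have [N _ dimN] := has_dim_add X_curve DZ dimD; exists N.
by have := has_dim_equiv v0 vZ dimN; rewrite addrA addrK -mulr2n.
Qed.

(* Multiplying by [v0 ^+ k.+1 * v] moves [D + A] plus [k] times the divisor of
   [v0] as a section of [L(D)] to the divisor below. *)
Lemma nonspecial_two_sections k A v0 v Z0 Z : nonspecial (D + A) ->
  v0 != 0 -> is_div v0 Z0 -> div_le 0 (D + Z0) -> v != 0 -> is_div v Z ->
  nonspecial (D *+ k.+3 + A - (D + Z0) - (D + Z)).
Proof.
move=> NA v0_0 v0Z0 DZ0 v_0 vZ.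
have fZ : is_div (v0 ^+ k.+1 * v) (Z0 *+ k.+1 + Z).
  move=> P; rewrite coeffD coeffMn v0Z0 vZ ordM ?expf_neq0 //.
  by rewrite ordX.
have -> : D *+ k.+3 + A - (D + Z0) - (D + Z) =
    D + A + (D + Z0) *+ k - (Z0 *+ k.+1 + Z).
  by apply/eqP/freeg_eqP => P; rewrite !(coeffD, coeffN, coeffMn) !mulrSr; lia.
apply: nonspecial_equiv fZ _; first by rewrite mulf_neq0 ?expf_neq0.
apply: nonspecial_le NA; apply: div_leDl => P.
by rewrite coeff0 coeffMn mulrn_wge0 //; have := DZ0 P; rewrite coeff0.
Qed.

(* The base divisor [M] of the part of [L((k + 3) D)] known to lie in [T] is
   decreased to [min(M, div v)] at each step, one point at a time. *)
Lemma products_fill k (T : set F) v0 : v0 != 0 -> lin_sys D v0 ->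
  (forall f h, T f -> T h -> T (f + h)) ->
  (forall v f, lin_sys D v -> lin_sys (D *+ k.+2) f -> T (v * f)) ->
  (forall b, exists v A, [/\ lin_sys (D - A) v, nonvanishing_at D b v,
     lin_sys (D - A) v0, div_le 0 A & nonspecial (D + A)]) ->
  lin_sys (D *+ k.+3) `<=` T.
Proof.
move=> v0_0 Lv0 TD TM Tb; have [Z0 v0Z0 DZ0] := div_exists X_curve X_genus v0_0 Lv0.
(* This linear system is [v] times [L((k + 2) D)]. *)
have T_section v Z : v != 0 -> is_div v Z -> lin_sys D v ->
    lin_sys (D *+ k.+3 - (D + Z)) `<=` T.
  move=> v_0 vZ Lv f; rewrite mulrSr opprD addrA addrK.
  move=> /(lin_sys_equiv _ _ v_0 vZ) Lf; rewrite -[f](divfK v_0) mulrC.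
  exact: TM.
suff shrink (n : nat) M : deg M <= n%:Z -> div_le 0 M -> div_le M (D + Z0) ->
    lin_sys (D *+ k.+3 - M) `<=` T -> lin_sys (D *+ k.+3) `<=` T.
  have [n le_n] : exists n : nat, deg (D + Z0) <= n%:Z.
    by exists `|(deg (D + Z0))%R|%N; lia.
  exact: (shrink _ _ le_n DZ0 (div_lexx _) (T_section _ _ v0_0 v0Z0 Lv0)).
elim: n M => [|n IH] M le_n M0 MZ0 TM';
  have [M_0|Mn0] := eqVneq M 0; try by rewrite M_0 subr0 in TM'.
  have := deg_ge0 M0 => deg0; case/eqP: Mn0.
  apply: fgpos_eq0P; last by lia.
  by apply/fgposP => P; have := M0 P; rewrite coeff0.
have [b bM] := effective_gt0 M0 Mn0.
have [v [A [LAv [v_0 bv] LAv0 A0 NA]]] := Tb b.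
have Lv : lin_sys D v.
  by apply: lin_sys_le LAv; rewrite -{2}(subrK A D); apply: div_leDl.
have [Z vZ DZ] := div_exists X_curve X_genus v_0 Lv.
have [M' M'E] : exists M', forall P,
    coeff P M' = Num.min (coeff P M) (coeff P (D + Z)).
  by exists (M - fgpos (M - (D + Z))) => P; rewrite coeffB coeff_fgpos coeffB; lia.
(* As [v] does not vanish at [b], [D + Z] is 0 there, so [M'] is strictly below [M] at [b]. *)
have le_M' : deg M' <= n%:Z.
  have : div_le M' (M - << b >>).
    move=> P; rewrite M'E coeffB coeff_point; case: eqP => [<-|_]; last by lia.
    by rewrite coeffD vZ bv; lia.
  by move=> /deg_le; rewrite degB degU; lia.
have M'0 : div_le 0 M' by move=> P; rewrite M'E; have := M0 P; have := DZ P; lia.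
have M'Z0 : div_le M' (D + Z0) by move=> P; rewrite M'E; have := MZ0 P; lia.
apply: (IH _ le_M' M'0 M'Z0) => f Lf.
have AZ0 P : coeff P A <= coeff P (D + Z0).
  by have := lin_sys_ord P v0_0 LAv0; rewrite coeffB coeffD v0Z0; lia.
have AZ P : coeff P A <= coeff P (D + Z).
  by have := lin_sys_ord P v_0 LAv; rewrite coeffB coeffD vZ; lia.
(* The nonspecial divisor lies below both [E1] and [E2], since [M] is at most [D + Z0] and [A] is at
   most [D + Z] and [D + Z0]. The maximum of [E1] and [E2] is [D *+ k.+3 - M']. *)
have [|||f1 [f2 [Lf1 Lf2 ->]]] := lin_sys_sum X_curve (E1 := D *+ k.+3 - M)
    (E2 := D *+ k.+3 - (D + Z)) (f := f)
    (nonspecial_two_sections (k := k) NA v0_0 v0Z0 DZ0 v_0 vZ).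
- move=> P; have := MZ0 P; have := AZ P.
  by rewrite !coeffB (coeffD _ (D *+ _)); lia.
- move=> P; have := AZ0 P.
  by rewrite !coeffB (coeffD _ (D *+ _)); lia.
- move=> P; have /lin_sysP/(_ P) := Lf; apply: order_ge_trans.
  by rewrite !coeffB M'E; lia.
by apply: TD; [apply: (TM' _ Lf1)|apply: (T_section _ _ v_0 vZ Lv _ Lf2)].
Qed.

End Descent.

Theorem theorem1p2
  (R : realType) (K : closedFieldType) (v : K -> R)
  (v_valuation : is_valuation v)
  (v_full : full_value_group v)
  (K_sph_complete : spherically_complete v)
  (K_char0 : [pchar K] =i pred0)
  (g r : nat) (d : int)
  (r_ge3 : (3 <= r)%N)
  (rho_ge0 : 0 <= rho g r d)
  (d_lt : d < g%:Z + r%:Z)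
  (len_top len_bot : 'I_g -> R) (len_bridge : 'I_g.+1 -> R)
  (lengths_admissible : admissible len_top len_bot len_bridge)
  (F : fieldType) (iota : {rmorphism K -> F})
  (X_curve : function_field iota)
  (X_genus : has_genus iota g)
  (X_skeleton : has_skeleton_isometric_to v iota
                  (chain_of_loops len_top len_bot len_bridge))
  (D : divisor iota)
  (D_degree : deg D = d)
  (b : 'I_r.+1 -> F)
  (D_rank : is_basis iota (lin_sys D) b)
  (D_very_ample : very_ample D b)
  (mu2_max_rank : mult_max_rank D b 2)
  (mu2_surjective : mult_surjective D b 2) :
  forall m : nat, (2 <= m)%N -> mult_surjective D b m.
Proof.
have dimD : has_dim D r.+1 by exists b.
(* By [d_lt] this difference is positive. *)
have [h hE] : exists h : nat, h%:Z = g%:Z - d + r%:Z by exists `|(g%:Z - d + r%:Z)%R|%N; lia.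
have le_hr : (h.*2 <= r)%N.
  have [|u u0] := section_vanishing X_curve dimD (div_lexx 0); first by rewrite deg0.
  rewrite subr0 => Lu; have [N dimN] := has_dim_double X_curve X_genus u0 Lu dimD.
  have [[c c_basis] [a a_span]] := (dimN, mult_image_dim iota b 2).
  have : (N <= 'C(2 + r, 2))%N.
    apply: (independent_le (is_basis_independent (lin_sys0 _) c_basis)) => i.
    by apply: a_span; apply: mu2_surjective; case: c_basis.
  have := riemann_inequality X_genus dimN.
  rewrite degMn D_degree bin2 geq_half_double /= => le1 le2.
  have le3 : (r%:Z + 1) * h%:Z <= g%:Z by move: rho_ge0; rewrite /rho hE; lia.
  have {}le2 : (N + N <= (r + 2) * (r + 1))%N by lia.
  (* This is [2 h (r - 1) <= r (r - 1)], where [r - 1] is positive. *)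
  have : r%:Z * (2 * h%:Z) - 2 * h%:Z <= r%:Z * r%:Z - r%:Z by nia.
  nia.
have nonspec A : div_le 0 A -> deg A = h%:Z ->
    nonspecial (D + A) \/ lin_sys (D + A) `<=` lin_sys D -> nonspecial (D + A).
  move=> A0 degA sA; apply: (nonspecial_of_stationary X_curve X_genus dimD _ degA _ sA A0) => //.
  (* The choice of [h] makes [d + h + 2 - (r + 1)] equal to [g + 1]. *)
  by rewrite D_degree; lia.
have [X [X0 degX /(nonspec _ X0 degX) NX _]] :=
  general_points X_curve X_genus dimD (S := [::]) (k := h) ltac:(lia) ltac:(done).
have [|u u0 LXu] := section_vanishing X_curve dimD X0; first by rewrite degX; lia.
have subD A : div_le 0 A -> lin_sys (D - A) `<=` lin_sys D.
  by move=> A0; apply: lin_sys_le; rewrite -{2}(subrK A D); apply: div_leDl.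
have [U uU DU] := div_exists X_curve X_genus u0 (subD _ X0 _ LXu).
(* [dom (D + U)] is the set of zeros of [u] as a section of [O(D)]; at each of them some section in
   [L(D - Y)] does not vanish. *)
have [||Y [Y0 degY /(nonspec _ Y0 degY) NY bY]] :=
  general_points X_curve X_genus dimD (S := dom (D + U)) (k := h).
- by lia.
- case: D_very_ample => bpf _ _ P _; have [w [Lw w0 Pw]] := bpf P.
  by exists w.
(* The degree of [X + Y] is [2 h <= r], below the dimension [r + 1]. *)
have [||v0 v0_0 Lv0] := section_vanishing X_curve dimD (A := X + Y).
- exact: div_leD.
- by rewrite degD degX degY; lia.
have LXv0 : lin_sys (D - X) v0.
  by apply: lin_sys_le Lv0; rewrite opprD addrA -{2}(subrK Y (D - X)); apply: div_leDl.
have LYv0 : lin_sys (D - Y) v0.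
  by apply: lin_sys_le Lv0; rewrite opprD addrCA addrC -{2}(subrK X (D - Y)) addrAC; apply: div_leDl.
(* For [m = 1] the goal is the hypothesis on [mu_2]; otherwise [m >= 2] and the induction hypothesis
   applies. *)
elim=> [//|m IH] lt_m; have [m1|m1] := eqVneq m 1%N; first by rewrite m1.
have {}IH : mult_surjective D b m by apply: IH; lia.
have [k mE] : exists k, m = k.+2 by exists (m - 2)%N; lia.
subst m.
apply: (products_fill X_curve X_genus v0_0 (subD _ X0 _ LXv0)).
- exact: mult_imageD.
- by move=> w f /(is_basis_span D_rank) bw /IH; apply: mult_image_span.
(* At a zero of [u] the pair is a section of [L(D - Y)] with [Y]; elsewhere it is [u] with [X]. *)
move=> P; have [/bY [w Lw wP]|] := boolP (P \in dom (D + U)).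
  by exists w, Y; split.
rewrite mem_dom negbK coeffD uU addr_eq0 => /eqP Pu.
exists u, X; split=> //; split=> //; lia.
Qed.
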